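(* Let $D\ge4$, $k\in\{1,0,-1\}$, and let $\alpha_{n,j}$ ($0\le n\le n_{\max}$, $0\le j\le n$) be arbitrary real constants. Define, for $r_h>0$ and $T>0$, $$M=-\frac{\Omega_{D-2}}{16\pi G_N}\sum_{n=0}^{n_{\max}}\sum_{j=0}^n\alpha_{n,j}(j-1)k^{n-j}r_h^{D-2n-1}(-2\pi r_hT)^j,$$ $$S=\frac{\Omega_{D-2}}{8G_N}\sum_{n=0}^{n_{\max}}\sum_{j=0}^n\alpha_{n,j}\,j\,k^{n-j}(-2\pi r_hT)^{j-1}r_h^{D-2n}.$$ These are the mass and Wald entropy of a static black hole of horizon radius $r_h$ and temperature $T$ in the theory with the given couplings, and $r_h,T$ are related by $$\sum_{n=0}^{n_{\max}}\sum_{j=0}^n\alpha_{n,j}(D-2n+j-1)k^{n-j}(-2\pi r_hT)^jr_h^{D-2n-2}=0 .$$ Then, along any differentiable family of pairs $(r_h,T)$ satisfying this relation, the first law $dM=T\,dS$ holds. In particular it holds independently of any constraint on the couplings $\alpha_{n,j}$.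
   Context: The theory has, on the metric $ds^2=-f\,dt^2+dr^2/f+r^2d\Sigma_k^2$ (with $d\Sigma_k^2$ the unit sphere, flat or hyperbolic $(D-2)$-metric for $k=1,0,-1$, and $\Omega_{D-2}$ its volume), the integrated field equation $\sum_{n,j}\alpha_{n,j}\mathcal{F}_{(n,j)}=-8\pi G_NM/\Omega_{D-2}$, where $$\mathcal{F}_{(n,j)}=\tfrac{(-1)^{j+1}}{2^{j+1}}r^{D-2+j-2n}(k-f)^{n-j-1}(f')^{j-2}\Big\{f'\big[j(D-1+j-2n)(k-f)f-(j-1)r\,(k+(n-j-1)f)f'\big]+j(j-1)r(k-f)ff''\Big\}.$$ The horizon is at $f(r_h)=0$ and $T=f'(r_h)/(4\pi)$; the formula for $M$ and the relation between $r_h$ and $T$ are the first two orders of the expansion of this equation around $r=r_h$. For terms with $j=0$ the factor $j(-2\pi r_hT)^{j-1}$ is understood as $0$. *)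

(* Defs.v *)
From Stdlib Require Import Reals ZArith.
From Coquelicot Require Import Coquelicot.
Open Scope R_scope.

(** Throughout, [k] is the curvature of the transverse space and [Omega] its
    volume, kept as a parameter because for [k = 0, -1] it depends on the chosen
    quotient; [G] is Newton's constant and [alpha n j] are the couplings. *)

(** The sum of [alpha n j * X n j] over [0 <= n <= nmax], [0 <= j <= n]
    ([sum_f_R0] includes its upper bound). *)
Definition coupling_sum (nmax : nat) (alpha X : nat -> nat -> R) : R :=
  sum_f_R0 (fun n => sum_f_R0 (fun j => alpha n j * X n j) n) nmax.

(** Exponents that can be negative are integers, whence [powerRZ].  The exponent
    of [k - f r] is [-1] when [j = n], and that of [f'] is negative when [j < 2]. *)
Definition F (D : nat) (k : R) (n j : nat) (f : R -> R) (r : R) : R :=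
  let d := INR D in
  let nn := INR n in
  let jj := INR j in
  let f0 := f r in
  let f1 := Derive f r in
  let f2 := Derive_n f 2 r in
  (-1) ^ (j + 1) / 2 ^ (j + 1)
  * powerRZ r (Z.of_nat D - 2 + Z.of_nat j - 2 * Z.of_nat n)
  * powerRZ (k - f0) (Z.of_nat n - Z.of_nat j - 1)
  * powerRZ f1 (Z.of_nat j - 2)
  * (f1 * (jj * (d - 1 + jj - 2 * nn) * (k - f0) * f0
           - (jj - 1) * r * (k + (nn - jj - 1) * f0) * f1)
     + jj * (jj - 1) * r * (k - f0) * f0 * f2).

(** The field equation is required just outside the horizon and not at
    [r = rh] itself: for [k = 0] and [j = n] the factor [(k - f) ^ (-1)] of [F]
    has a (removable) singularity there. *)
Record static_black_hole (D nmax : nat) (k : R) (alpha : nat -> nat -> R)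
    (G Omega : R) (f : R -> R) (M rh T : R) : Prop := {
  sbh_radius_pos : 0 < rh;
  sbh_temperature_pos : 0 < T;
  sbh_derivable :
    locally rh (fun r => ex_derive f r /\ ex_derive_n f 2 r);
  sbh_C2 : locally rh (fun r => continuous (Derive_n f 2) r);
  sbh_horizon : f rh = 0;
  sbh_temperature : T = Derive f rh / (4 * PI);
  sbh_field_equation :
    at_right rh (fun r =>
      coupling_sum nmax alpha (fun n j => F D k n j f r)
      = - (8 * PI * G * M) / Omega)
}.

(** Here [0 ^ 0 = 1], so for [k = 0] only the terms with [j = n] survive. *)
Definition mass (D nmax : nat) (k : R) (alpha : nat -> nat -> R)
    (G Omega rh T : R) : R :=
  - (Omega / (16 * PI * G))
  * coupling_sum nmax alpha (fun n j =>
      (INR j - 1) * k ^ (n - j)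
      * powerRZ rh (Z.of_nat D - 2 * Z.of_nat n - 1)
      * (- 2 * PI * rh * T) ^ j).

(** The terms with [j = 0] vanish because of the factor [INR j]. *)
Definition wald_entropy (D nmax : nat) (k : R) (alpha : nat -> nat -> R)
    (G Omega rh T : R) : R :=
  Omega / (8 * G)
  * coupling_sum nmax alpha (fun n j =>
      INR j * k ^ (n - j)
      * powerRZ (- 2 * PI * rh * T) (Z.of_nat j - 1)
      * powerRZ rh (Z.of_nat D - 2 * Z.of_nat n)).

Definition horizon_relation (D nmax : nat) (k : R) (alpha : nat -> nat -> R)
    (rh T : R) : Prop :=
  coupling_sum nmax alpha (fun n j =>
    (INR D - 2 * INR n + INR j - 1) * k ^ (n - j)
    * (- 2 * PI * rh * T) ^ j
    * powerRZ rh (Z.of_nat D - 2 * Z.of_nat n - 2)) = 0.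

(* Main.v *)
Require Import Defs.
From Stdlib Require Import Reals ZArith Lia Lra.
From Coquelicot Require Import Coquelicot.
Open Scope R_scope.

(** Outside the horizon each [F] agrees with an expression that is regular at
    [rh] and, although [f] is only [C^2], differentiable there: [f''] enters
    only through the product [f * f''].  A sum that is constant to the right of
    [rh] then has that constant as value at [rh] and derivative [0]; these are
    the formula for [M] and the horizon relation.  In the derivative the two
    contributions of [f''] cancel, and so does the one of [k - f], because
    [(k + (m - 1) u) (k - u) ^ (m - 1) = k ^ m + O(u ^ 2)].

    For the first law, write [x = - 2 PI rh T], so that [T = - x / (2 PI rh)].
    The [x'] terms of [M'] and [T S'] agree term by term in the sum, and the
    [rh'] terms differ by
    [(j - 1) (D - 2 n - 1) - j (D - 2 n) = - (D - 2 n + j - 1)],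
    that is, by a multiple of the horizon relation. *)

(** * Linearity and termwise differentiation of coupling sums *)

Lemma coupling_sum_ext (nmax : nat) (alpha X Y : nat -> nat -> R) :
  (forall n j, (j <= n)%nat -> X n j = Y n j) ->
  coupling_sum nmax alpha X = coupling_sum nmax alpha Y.
Proof.
  intros H; apply sum_eq; intros n _; apply sum_eq; intros j Hj.
  now rewrite H.
Qed.

Lemma coupling_sum_scal (nmax : nat) (alpha X : nat -> nat -> R) (c : R) :
  coupling_sum nmax alpha (fun n j => c * X n j)
  = c * coupling_sum nmax alpha X.
Proof.
  unfold coupling_sum; rewrite scal_sum; apply sum_eq; intros n _.
  rewrite Rmult_comm, scal_sum; apply sum_eq; intros j _; ring.
Qed.

Lemma coupling_sum_plus (nmax : nat) (alpha X Y : nat -> nat -> R) :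
  coupling_sum nmax alpha (fun n j => X n j + Y n j)
  = coupling_sum nmax alpha X + coupling_sum nmax alpha Y.
Proof.
  unfold coupling_sum; rewrite <- sum_plus; apply sum_eq; intros n _.
  rewrite <- sum_plus; apply sum_eq; intros j _; ring.
Qed.

Lemma is_derive_sum_f_R0 (N : nat) (g : nat -> R -> R) (dg : nat -> R) (x : R) :
  (forall n, (n <= N)%nat -> is_derive (g n) x (dg n)) ->
  is_derive (fun y => sum_f_R0 (fun n => g n y) N) x (sum_f_R0 dg N).
Proof.
  induction N as [|N IH]; intros H; simpl; [now apply H|].
  apply (is_derive_plus (fun y => sum_f_R0 (fun n => g n y) N) (g (S N))); auto.
Qed.

Lemma is_derive_coupling_sum (nmax : nat) (alpha : nat -> nat -> R)
    (X : nat -> nat -> R -> R) (dX : nat -> nat -> R) (x : R) :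
  (forall n j, (j <= n)%nat -> is_derive (X n j) x (dX n j)) ->
  is_derive (fun y => coupling_sum nmax alpha (fun n j => X n j y)) x
    (coupling_sum nmax alpha dX).
Proof.
  intros H; unfold coupling_sum.
  apply (is_derive_sum_f_R0 nmax
    (fun n y => sum_f_R0 (fun j => alpha n j * X n j y) n)); intros n _.
  apply (is_derive_sum_f_R0 n (fun j y => alpha n j * X n j y)); intros j Hj.
  now apply is_derive_scal, H.
Qed.

(** * Integer powers and first-order expansions at a point *)

Lemma powerRZ_pred (x : R) (z : Z) :
  x <> 0 -> powerRZ x (z - 1) = powerRZ x z / x.
Proof.
  intros Hx; unfold Z.sub; rewrite powerRZ_add by easy; simpl.
  now field.
Qed.

Lemma is_derive_powerRZ (f : R -> R) (z : Z) (x l : R) :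
  f x <> 0 -> is_derive f x l ->
  is_derive (fun u => powerRZ (f u) z) x (IZR z * l * powerRZ (f x) (z - 1)).
Proof.
  intros Hx Hf; rewrite powerRZ_pred by easy.
  (* Writing the derivative with [f x ^ n / f x] instead of [pred n] treats [n = 0] uniformly and
     suits both signs of [z]. *)
  assert (Hpos : forall n : nat,
    is_derive (fun u => f u ^ n) x (INR n * l * f x ^ n / f x)).
  { intros n; evar_last; [apply is_derive_pow; exact Hf |].
    destruct n as [|n]; simpl; now field. }
  destruct (Z.le_gt_cases 0 z) as [Hz|Hz].
  - rewrite <- (Z2Nat.id z Hz).
    apply is_derive_ext with (fun u => f u ^ Z.to_nat z).
    + intros u; apply pow_powerRZ.
    + rewrite <- pow_powerRZ, <- INR_IZR_INZ.
      evar_last; [apply Hpos | now field].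
  - replace z with (- Z.of_nat (Z.to_nat (- z)))%Z by lia.
    set (n := Z.to_nat (- z)); clearbody n.
    apply is_derive_ext with (fun u => / (f u ^ n)).
    + intros u; now rewrite powerRZ_neg', <- pow_powerRZ.
    + rewrite powerRZ_neg', <- pow_powerRZ, opp_IZR, <- INR_IZR_INZ.
      assert (f x ^ n <> 0) by now apply pow_nonzero.
      evar_last; [apply is_derive_inv; [apply Hpos | easy] | simpl; now field].
Qed.

(* The factor [g] need not be differentiable: this is what lets [f * f''] be
   expanded to first order at the horizon when [f] is only [C^2]. *)
Lemma is_derive_mult_zero (b g : R -> R) (x l : R) :
  b x = 0 -> is_derive b x l -> continuous g x ->
  is_derive (fun u => b u * g u) x (l * g x).
Proof.
  intros Hb Hd Hg.
  apply is_derive_Reals, derivable_pt_lim_D_in with (df := fun _ => l * g x).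
  apply is_derive_Reals, derivable_pt_lim_D_in with (df := fun _ => l) in Hd.
  apply continuity_pt_filterlim in Hg.
  unfold D_in in *.
  (* As [b x = 0], the difference quotient of the product is that of [b] times [g u], so a product
     of limits suffices. *)
  generalize (limit_mul _ _ _ _ _ _ Hd Hg).
  apply limit1_ext.
  intros u _; rewrite Hb; unfold Rdiv; ring.
Qed.

(** Continuity from the right fixes the value. If [l] were nonzero, the difference quotient at a
    small positive [e], which is [0], would have to lie within [Rabs l] of [l]. *)
Lemma is_derive_const_at_right (h : R -> R) (x l c : R) :
  is_derive h x l -> at_right x (fun u => h u = c) -> h x = c /\ l = 0.
Proof.
  intros Hd Hc.
  assert (Hx : h x = c).
  { assert (Hcont : filterlim h (at_right x) (locally (h x))).
    { eapply filterlim_filter_le_1.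
      - apply filter_le_within.
      - apply (ex_derive_continuous h); now exists l. }
    symmetry.
    apply (filterlim_locally_unique (F := at_right x) h); [|easy].
    apply filterlim_ext_loc with (fun _ => c); [|apply filterlim_const].
    revert Hc; apply filter_imp; congruence. }
  split; [easy|].
  destruct (Req_dec l 0) as [|Hl]; [easy|exfalso].
  apply is_derive_Reals in Hd.
  destruct (Hd (Rabs l) (Rabs_pos_lt _ Hl)) as [d1 H1].
  destruct Hc as [d2 H2].
  set (e := Rmin d1 d2 / 2).
  assert (He : 0 < e < d1 /\ e < d2).
  { pose proof (cond_pos d1); pose proof (cond_pos d2).
    unfold e, Rmin; destruct (Rle_dec d1 d2); lra. }
  assert (Heq : h (x + e) = c).
  { apply H2; [|lra].
    change (Rabs (x + e - x) < d2).
    rewrite Rabs_right; lra. }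
  specialize (H1 e ltac:(lra)).
  rewrite Heq, Hx, Rabs_right in H1 by lra.
  specialize (H1 ltac:(lra)).
  replace ((c - c) / e - l) with (- l) in H1 by (field; lra).
  rewrite Rabs_Ropp in H1; lra.
Qed.

(* [(k + (m - 1) u) (k - u) ^ (m - 1)] with the singularity for [m = 0] removed. *)
Definition horizon_factor (k : R) (m : nat) (u : R) : R :=
  match m with
  | O => 1
  | S m' => (k + INR m' * u) * (k - u) ^ m'
  end.

Lemma horizon_factor_0 (k : R) (m : nat) : horizon_factor k m 0 = k ^ m.
Proof.
  destruct m as [|m]; simpl; [easy|].
  now rewrite Rmult_0_r, Rplus_0_r, Rminus_0_r.
Qed.

Lemma is_derive_horizon_factor (k : R) (m : nat) (f : R -> R) (x l : R) :
  f x = 0 -> is_derive f x l ->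
  is_derive (fun u => horizon_factor k m (f u)) x 0.
Proof.
  intros Hx Hf; destruct m as [|m]; simpl.
  - apply (is_derive_const 1).
  - evar_last.
    + apply Derive.is_derive_mult.
      * apply (is_derive_plus (fun _ => k) (fun u => INR m * f u)).
        -- apply (is_derive_const k).
        -- apply is_derive_scal; exact Hf.
      * apply is_derive_pow.
        apply (is_derive_minus (fun _ => k) f); [apply (is_derive_const k)|].
        exact Hf.
    + cbv beta; rewrite Hx; unfold minus, plus, opp, zero; simpl.
      rewrite Rminus_0_r.
      (* The linear factor contributes [INR m * l * k ^ m] and the power
         [- k * INR m * l * k ^ pred m]; these cancel once [m = 0] is split off. *)
      destruct m as [|m]; simpl; ring.
Qed.

(** For [j = n] the second factor is [k - u], which cancels the exponent [-1]. *)
Lemma horizon_factor_powerRZ (k u : R) (n j : nat) :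
  (j <= n)%nat -> k - u <> 0 ->
  powerRZ (k - u) (Z.of_nat n - Z.of_nat j - 1)
  * (k + (INR n - INR j - 1) * u)
  = horizon_factor k (n - j) u.
Proof.
  intros Hj Hu.
  rewrite powerRZ_pred, <- Nat2Z.inj_sub, <- pow_powerRZ, <- minus_INR by easy.
  destruct (n - j)%nat as [|m]; simpl horizon_factor.
  - simpl; now field.
  - rewrite S_INR; simpl; now field.
Qed.

(** * Value and derivative of the regularised field equation at the horizon *)

(** The braces of [F] multiplied out by the power of [k - f]: two terms already contain [k - f] and
    reach the natural exponent [n - j], the third becomes [horizon_factor]. *)
Definition F_regular (D : nat) (k : R) (n j : nat) (f : R -> R) (r : R) : R :=
  (-1) ^ (j + 1) / 2 ^ (j + 1)
  * powerRZ r (Z.of_nat D - 2 + Z.of_nat j - 2 * Z.of_nat n)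
  * powerRZ (Derive f r) (Z.of_nat j - 2)
  * (INR j * (INR D - 1 + INR j - 2 * INR n)
       * (k - f r) ^ (n - j) * f r * Derive f r
     - (INR j - 1) * r * horizon_factor k (n - j) (f r) * Derive f r ^ 2
     + INR j * (INR j - 1) * r * (k - f r) ^ (n - j) * f r * Derive_n f 2 r).

Lemma F_regular_eq (D : nat) (k : R) (n j : nat) (f : R -> R) (r : R) :
  (j <= n)%nat -> k - f r <> 0 -> F_regular D k n j f r = F D k n j f r.
Proof.
  intros Hj Hr; unfold F_regular, F; cbv zeta.
  rewrite <- horizon_factor_powerRZ by easy.
  replace ((k - f r) ^ (n - j))
    with (powerRZ (k - f r) (Z.of_nat n - Z.of_nat j - 1) * (k - f r)).
  - ring.
  - rewrite powerRZ_pred, <- Nat2Z.inj_sub, <- pow_powerRZ by easy.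
    now field.
Qed.

(** Since [x * f1 / 2 = 2 * PI * x * T], the powers of [-1], [2], [x] and [f1] combine into a single
    [j]-th power. Both orders of the expansion carry this factor. *)
Lemma horizon_prefactor (j : nat) (p : Z) (x T f1 : R) :
  x <> 0 -> f1 = 4 * PI * T -> f1 <> 0 ->
  (-1) ^ (j + 1) / 2 ^ (j + 1) * powerRZ x (p + Z.of_nat j)
    * powerRZ f1 (Z.of_nat j - 2) * f1 ^ 2
  = - / 2 * (powerRZ x p * (- 2 * PI * x * T) ^ j).
Proof.
  intros Hx Hf Hf0.
  replace (Z.of_nat j - 2)%Z with (Z.of_nat j - 1 - 1)%Z by lia.
  rewrite !powerRZ_pred, powerRZ_add, <- !pow_powerRZ by easy.
  replace (- 2 * PI * x * T) with (- 1 * (x * (f1 * / 2))) by (rewrite Hf; field).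
  rewrite !pow_add, !Rpow_mult_distr, !pow_inv.
  assert (2 ^ j <> 0) by (apply pow_nonzero; lra).
  field; auto.
Qed.

(** With [f rh = 0] only the [horizon_factor] term survives; its explicit [r] raises the exponent of
    [rh] by one. *)
Lemma F_regular_horizon (D : nat) (k : R) (n j : nat) (f : R -> R) (rh T : R) :
  0 < rh -> 0 < T -> f rh = 0 -> Derive f rh = 4 * PI * T ->
  F_regular D k n j f rh
  = / 2 * ((INR j - 1) * k ^ (n - j)
           * powerRZ rh (Z.of_nat D - 2 * Z.of_nat n - 1)
           * (- 2 * PI * rh * T) ^ j).
Proof.
  intros rh_pos T_pos f_horizon f_temperature.
  assert (Hf1 : Derive f rh <> 0).
  { rewrite f_temperature; pose proof PI_RGT_0; nra. }
  pose proof (horizon_prefactor j (Z.of_nat D - 2 * Z.of_nat n - 2) rh T _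
    ltac:(lra) f_temperature Hf1) as H.
  replace (Z.of_nat D - 2 * Z.of_nat n - 2 + Z.of_nat j)%Z
    with (Z.of_nat D - 2 + Z.of_nat j - 2 * Z.of_nat n)%Z in H by lia.
  replace (Z.of_nat D - 2 * Z.of_nat n - 2)%Z
    with (Z.of_nat D - 2 * Z.of_nat n - 1 - 1)%Z in H by lia.
  rewrite (powerRZ_pred rh (Z.of_nat D - 2 * Z.of_nat n - 1)) in H by lra.
  unfold F_regular; rewrite f_horizon, horizon_factor_0.
  match type of H with ?A * _ ^ 2 = _ => set (a := A) in * end.
  transitivity (- (INR j - 1) * rh * k ^ (n - j) * (a * Derive f rh ^ 2));
    [ring|].
  rewrite H; field; lra.
Qed.

Lemma is_derive_F_regular_horizon (D : nat) (k : R) (n j : nat) (f : R -> R)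
    (rh T : R) :
  0 < rh -> 0 < T -> f rh = 0 -> Derive f rh = 4 * PI * T ->
  ex_derive f rh -> ex_derive_n f 2 rh -> continuous (Derive_n f 2) rh ->
  is_derive (F_regular D k n j f) rh
    (- / 2 * ((INR D - 2 * INR n + INR j - 1) * k ^ (n - j)
              * (- 2 * PI * rh * T) ^ j
              * powerRZ rh (Z.of_nat D - 2 * Z.of_nat n - 2))).
Proof.
  intros rh_pos T_pos f_horizon f_temperature f_derive f_derive2 f_C2.
  assert (Hf1 : Derive f rh <> 0).
  { rewrite f_temperature; pose proof PI_RGT_0; nra. }
  pose proof (horizon_prefactor j (Z.of_nat D - 2 * Z.of_nat n - 2) rh T _
    ltac:(lra) f_temperature Hf1) as H.
  replace (Z.of_nat D - 2 * Z.of_nat n - 2 + Z.of_nat j)%Z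
    with (Z.of_nat D - 2 + Z.of_nat j - 2 * Z.of_nat n)%Z in H by lia.
  assert (Df : is_derive f rh (Derive f rh)) by now apply Derive_correct.
  assert (Df1 : is_derive (Derive f) rh (Derive_n f 2 rh))
    by (apply Derive_correct; exact f_derive2).
  assert (Dk : is_derive (fun r => (k - f r) ^ (n - j)) rh
    (INR (n - j) * - Derive f rh * k ^ pred (n - j))).
  { evar_last.
    - apply is_derive_pow.
      apply (is_derive_minus (fun _ => k) f); [apply (is_derive_const k)|].
      exact Df.
    - cbv beta; rewrite f_horizon; unfold minus, plus, opp, zero; simpl.
      rewrite Rminus_0_r; ring. }
  pose proof (is_derive_horizon_factor k (n - j) f rh _ f_horizon Df) as DA.
  pose proof (is_derive_id (K := R_AbsRing) rh) as Did.
  set (f1 := Derive f rh) in *; set (f2 := Derive_n f 2 rh) in *.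
  set (c := (-1) ^ (j + 1) / 2 ^ (j + 1)) in *.
  set (p := (Z.of_nat D - 2 + Z.of_nat j - 2 * Z.of_nat n)%Z) in *.
  set (q := INR j * (INR D - 1 + INR j - 2 * INR n)).
  assert (E1 : is_derive
    (fun r => q * (k - f r) ^ (n - j) * f r * Derive f r) rh
    (q * k ^ (n - j) * f1 ^ 2)).
  { evar_last.
    - apply Derive.is_derive_mult; [|exact Df1].
      apply Derive.is_derive_mult; [|exact Df].
      apply is_derive_scal; exact Dk.
    - cbv beta; rewrite f_horizon, Rminus_0_r; fold f1; ring. }
  assert (E2 : is_derive
    (fun r => (INR j - 1) * r * horizon_factor k (n - j) (f r) * Derive f r ^ 2)
    rh
    ((INR j - 1) * k ^ (n - j) * f1 ^ 2
     + (INR j - 1) * rh * k ^ (n - j) * (2 * f1 * f2))).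
  { evar_last.
    - apply Derive.is_derive_mult; [|apply is_derive_pow; exact Df1].
      apply Derive.is_derive_mult; [|exact DA].
      apply is_derive_scal; exact Did.
    - cbv beta; rewrite f_horizon, horizon_factor_0;
      fold f1; simpl; unfold one; simpl; ring. }
  assert (E3 : is_derive
    (fun r => INR j * (INR j - 1) * r * (k - f r) ^ (n - j) * f r
              * Derive_n f 2 r) rh
    (INR j * (INR j - 1) * rh * k ^ (n - j) * f1 * f2)).
  { apply is_derive_mult_zero; [rewrite f_horizon; ring| |exact f_C2].
    evar_last.
    - apply Derive.is_derive_mult; [|exact Df].
      apply Derive.is_derive_mult; [|exact Dk].
      apply is_derive_scal; exact Did.
    - cbv beta; rewrite f_horizon, Rminus_0_r; ring. }
  assert (Hrh : rh <> 0) by lra.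
  unfold F_regular; fold c p q.
  evar_last.
  { apply Derive.is_derive_mult.
    - apply Derive.is_derive_mult.
      + apply is_derive_scal.
        apply (is_derive_powerRZ (fun r => r)); [exact Hrh | exact Did].
      + apply is_derive_powerRZ; [exact Hf1 | exact Df1].
    - exact (is_derive_plus _ _ _ _ _ (is_derive_minus _ _ _ _ _ E1 E2) E3). }
  cbv beta; fold f1 f2.
  rewrite f_horizon, horizon_factor_0, 2!powerRZ_pred by easy.
  replace (IZR p) with (INR D - 2 + INR j - 2 * INR n)
    by (unfold p; rewrite minus_IZR, plus_IZR, minus_IZR, mult_IZR,
          <- !INR_IZR_INZ; ring).
  replace (IZR (Z.of_nat j - 2)) with (INR j - 2)
    by (rewrite minus_IZR, <- INR_IZR_INZ; ring).
  set (C := powerRZ rh (Z.of_nat D - 2 * Z.of_nat n - 2)) in *.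
  unfold minus, plus, opp, one; simpl.
  set (A := powerRZ rh p) in *.
  set (B := powerRZ f1 (Z.of_nat j - 2)) in *.
  (* The coefficient of [f1 * f2] is proportional to [- (j - 1) (j - 2) - 2 (j - 1) + j (j - 1) =
     0]. With [N = D - 1 + j - 2 n], that of [f1 ^ 2] is [j N - (j - 1) - (j - 1) (N - 1) = N]. *)
  transitivity ((INR D - 2 * INR n + INR j - 1) * k ^ (n - j)
    * (c * A * B * f1 ^ 2)).
  - unfold q; field; easy.
  - rewrite H; ring.
Qed.

(** * Mass formula and horizon relation from the field equation *)

Lemma static_black_hole_mass_and_relation (D nmax : nat) (k : R)
    (alpha : nat -> nat -> R) (G Omega : R) (f : R -> R) (M rh T : R) :
  0 < G -> 0 < Omega -> static_black_hole D nmax k alpha G Omega f M rh T ->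
  M = mass D nmax k alpha G Omega rh T /\ horizon_relation D nmax k alpha rh T.
Proof.
  intros HG HO [Hr HT Hd HC Hf HfT Heq].
  destruct (locally_singleton _ _ Hd) as [Hd1 Hd2].
  apply locally_singleton in HC.
  pose proof PI_RGT_0 as HPI.
  assert (Hf1 : Derive f rh = 4 * PI * T) by (rewrite HfT; field; lra).
  assert (Hreg : at_right rh (fun r =>
    coupling_sum nmax alpha (fun n j => F_regular D k n j f r)
    = - (8 * PI * G * M) / Omega)).
  { assert (Hne : at_right rh (fun r => k - f r <> 0)).
    (* For [k = 0], a zero of [f] close to the right of [rh] would give difference quotient [0], at
       distance exactly [4 * PI * T] from the derivative. For other [k], continuity of [f] is
       enough. *)
    { destruct (Req_dec k 0) as [Hk|Hk].
      - assert (Df : is_derive f rh (4 * PI * T))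
          by (rewrite <- Hf1; now apply Derive_correct).
        apply is_derive_Reals in Df.
        assert (Hpos : 0 < 4 * PI * T) by nra.
        destruct (Df _ Hpos) as [d Hdel].
        exists d.
        change (forall r : R, Rabs (r - rh) < d -> rh < r -> k - f r <> 0).
        intros r Hball Hlt Hkf.
        specialize (Hdel (r - rh) ltac:(lra) Hball).
        replace (rh + (r - rh)) with r in Hdel by ring.
        replace (f r) with 0 in Hdel by lra.
        rewrite Hf in Hdel.
        replace ((0 - 0) / (r - rh) - 4 * PI * T) with (- (4 * PI * T))
          in Hdel by (field; lra).
        rewrite Rabs_Ropp, Rabs_right in Hdel; lra.
      - apply filter_le_within.
        assert (Hc : continuous f rh) by now apply (ex_derive_continuous f).
        assert (Hopen : locally (f rh) (fun y => k - y <> 0)).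
        { rewrite Hf; exists (mkposreal _ (Rabs_pos_lt _ Hk)); intros y Hy Hky.
          change (Rabs (y - 0) < Rabs k) in Hy.
          apply Rminus_diag_uniq in Hky; subst y.
          rewrite Rminus_0_r in Hy; lra. }
        exact (Hc _ Hopen). }
    generalize (filter_and _ _ Hne Heq); apply filter_imp.
    intros r [Hkf <-]; apply coupling_sum_ext; intros n j Hj.
    now apply F_regular_eq. }
  destruct (is_derive_const_at_right _ _ _ _
    (is_derive_coupling_sum nmax alpha
      (fun n j r => F_regular D k n j f r) _ rh
      (fun n j _ => is_derive_F_regular_horizon D k n j f rh T
                      Hr HT Hf Hf1 Hd1 Hd2 HC))
    Hreg) as [H0 H1].
  rewrite coupling_sum_scal in H1.
  rewrite (coupling_sum_ext _ _ _ _
    (fun n j _ => F_regular_horizon D k n j f rh T Hr HT Hf Hf1)) in H0.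
  rewrite coupling_sum_scal in H0.
  split.
  - unfold mass.
    match type of H0 with _ * ?x = _ => set (s := x) in * end.
    replace s with (2 * (- (8 * PI * G * M) / Omega)) by lra.
    field; repeat split; lra.
  - unfold horizon_relation; lra.
Qed.

(** * The first law *)

Lemma first_law_along_curve (D nmax : nat) (k : R) (alpha : nat -> nat -> R)
    (G Omega : R) (rh T : R -> R) (s : R) :
  0 < G -> 0 < rh s -> 0 < T s -> ex_derive rh s -> ex_derive T s ->
  horizon_relation D nmax k alpha (rh s) (T s) ->
  exists dM dS : R,
    is_derive (fun u => mass D nmax k alpha G Omega (rh u) (T u)) s dM
    /\ is_derive (fun u => wald_entropy D nmax k alpha G Omega (rh u) (T u)) s dS
    /\ dM = T s * dS.
Proof.
  intros HG Hr HT [dr Dr] [dT DT] Hrel.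
  pose proof PI_RGT_0 as HPI.
  set (x := fun u => - 2 * PI * rh u * T u).
  set (dx := - 2 * PI * (dr * T s + rh s * dT)).
  assert (Hrs : rh s <> 0) by lra.
  assert (HrT : 0 < PI * (rh s * T s))
    by (apply Rmult_lt_0_compat; [exact HPI | now apply Rmult_lt_0_compat]).
  assert (Hx : x s <> 0) by (unfold x; lra).
  assert (Dx : is_derive x s dx).
  { evar_last.
    - apply Derive.is_derive_mult; [apply is_derive_scal; exact Dr | exact DT].
    - unfold dx; ring. }
  set (XM := fun (n j : nat) u => (INR j - 1) * k ^ (n - j)
    * powerRZ (rh u) (Z.of_nat D - 2 * Z.of_nat n - 1) * x u ^ j).
  set (XS := fun (n j : nat) u => INR j * k ^ (n - j)
    * powerRZ (x u) (Z.of_nat j - 1) * powerRZ (rh u) (Z.of_nat D - 2 * Z.of_nat n)).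
  (* Both derivatives are written as the term times its logarithmic derivative, so that they share
     the ratios [dr / rh s] and [dx / x s]. *)
  set (dXM := fun n j : nat => (INR j - 1) * k ^ (n - j) * x s ^ j
    * powerRZ (rh s) (Z.of_nat D - 2 * Z.of_nat n - 1)
    * ((INR D - 2 * INR n - 1) * dr / rh s + INR j * dx / x s)).
  set (dXS := fun n j : nat => INR j * k ^ (n - j) * x s ^ j / x s
    * powerRZ (rh s) (Z.of_nat D - 2 * Z.of_nat n)
    * ((INR j - 1) * dx / x s + (INR D - 2 * INR n) * dr / rh s)).
  assert (DM : forall n j, is_derive (XM n j) s (dXM n j)).
  { intros n j; unfold XM, dXM; evar_last.
    - apply Derive.is_derive_mult.
      + apply is_derive_scal, is_derive_powerRZ; [exact Hrs | exact Dr].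
      + apply is_derive_ext with (fun u => powerRZ (x u) (Z.of_nat j));
          [intros u; now rewrite pow_powerRZ|].
        apply is_derive_powerRZ; [exact Hx | exact Dx].
    - rewrite (powerRZ_pred (x s)), (powerRZ_pred _ (_ - 1)), <- pow_powerRZ by easy.
      rewrite !minus_IZR, mult_IZR, <- !INR_IZR_INZ; now field. }
  assert (DS : forall n j, is_derive (XS n j) s (dXS n j)).
  { intros n j; unfold XS, dXS; evar_last.
    - apply Derive.is_derive_mult.
      + apply is_derive_scal, is_derive_powerRZ; [exact Hx | exact Dx].
      + apply is_derive_powerRZ; [exact Hrs | exact Dr].
    - rewrite !powerRZ_pred, <- pow_powerRZ by easy.
      rewrite !minus_IZR, mult_IZR, <- !INR_IZR_INZ; now field. }
  exists (- (Omega / (16 * PI * G)) * coupling_sum nmax alpha dXM).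
  exists (Omega / (8 * G) * coupling_sum nmax alpha dXS).
  split; [|split].
  - apply is_derive_scal.
    now apply (is_derive_coupling_sum nmax alpha XM).
  - apply is_derive_scal.
    now apply (is_derive_coupling_sum nmax alpha XS).
  - unfold horizon_relation in Hrel.
    (* The literal [0] stands for the horizon relation: [rewrite <- Hrel] turns it back into a
       coupling sum, and the identity is then checked term by term. *)
    assert (Hdiff : coupling_sum nmax alpha dXM
      = - dr * 0 + - 2 * PI * T s * coupling_sum nmax alpha dXS).
    { rewrite <- Hrel, <- !coupling_sum_scal, <- coupling_sum_plus.
      apply coupling_sum_ext; intros n j _; unfold dXM, dXS; fold (x s).
      replace (Z.of_nat D - 2 * Z.of_nat n - 2)%Z
        with (Z.of_nat D - 2 * Z.of_nat n - 1 - 1)%Z by lia.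
      rewrite !(powerRZ_pred (rh s)) by easy.
      replace (- 2 * PI * T s) with (x s / rh s) by (unfold x; now field).
      field; easy. }
    rewrite Hdiff; field; lra.
Qed.

Theorem mainTheorem8 (D nmax : nat) (k : R) (alpha : nat -> nat -> R)
    (G Omega : R)
    (hD : (4 <= D)%nat) (hk : k = 1 \/ k = 0 \/ k = -1)
    (hG : 0 < G) (hOmega : 0 < Omega) :
  (forall (f : R -> R) (M rh T : R),
     static_black_hole D nmax k alpha G Omega f M rh T ->
     M = mass D nmax k alpha G Omega rh T
     /\ horizon_relation D nmax k alpha rh T)
  /\
  (forall (a b : Rbar) (rh T : R -> R),
     (forall s : R, Rbar_lt a s -> Rbar_lt s b ->
        0 < rh s /\ 0 < T s /\ ex_derive rh s /\ ex_derive T s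
        /\ horizon_relation D nmax k alpha (rh s) (T s)) ->
     forall s : R, Rbar_lt a s -> Rbar_lt s b ->
     exists dM dS : R,
       is_derive (fun u => mass D nmax k alpha G Omega (rh u) (T u)) s dM
       /\ is_derive
            (fun u => wald_entropy D nmax k alpha G Omega (rh u) (T u)) s dS
       /\ dM = T s * dS).
Proof.
  split.
  - intros f M rh T; now apply static_black_hole_mass_and_relation.
  - intros a b rh T Hcurve s Has Hsb.
    destruct (Hcurve s Has Hsb) as (Hr & HT & Dr & DT & Hrel).
    now apply first_law_along_curve.
Qed.
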